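(* Let $1\le p<\infty$ and let $B_w:\ell^p(\mathbb Z)\to\ell^p(\mathbb Z)$ be a bilateral weighted backward shift with weights $w=\{w_k\}_{k\in\mathbb Z}$. Then $B_w$ is frequently recurrent if and only if $B_w$ is frequently hypercyclic.
   Context: Given a bounded sequence $w=\{w_k\}_{k\in\mathbb Z}$ of positive real numbers, the bilateral weighted backward shift with weights $w$ is the bounded linear operator $B_w:\ell^p(\mathbb Z)\to\ell^p(\mathbb Z)$ defined by $(B_w x)(i)=w_{i+1}x_{i+1}$ for $i\in\mathbb Z$. Let $T:E\to E$ be a bounded linear operator on a separable Banach space $E$. A vector $x\in E$ is frequently recurrent for $T$ if for every neighborhood $U$ of $x$, $\liminf_{N\to\infty}\frac1N\#\{1\le n\le N: T^n x\in U\}>0$. The operator $T$ is frequently recurrent if its set of frequently recurrent vectors is dense in $E$. The operator $T$ is frequently hypercyclic if there is $x\in E$ such that for every non-empty open set $U\subseteq E$, $\liminf_{N\to\infty}\frac1N\#\{1\le n\le N: T^n x\in U\}>0$. *)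

(* Defs.v *)
From HB Require Import structures.
From mathcomp Require Import all_boot all_order all_algebra.
From mathcomp Require Import complex ring.
From mathcomp Require Import all_classical all_reals all_analysis.
Set Implicit Arguments.
Unset Strict Implicit.
Unset Printing Implicit Defensive.
Import Order.TTheory GRing.Theory Num.Theory.
Import numFieldNormedType.Exports.
Local Open Scope classical_set_scope.
Local Open Scope ring_scope.

(* liminf of #{1 <= n <= N | n \in A} / N, taken in the extended reals. *)
Definition lower_density (R : realType) (A : set nat) : \bar R :=
  limn_einf (fun N : nat =>
    ((count (fun n => n \in A) (iota 1 N))%:R / N%:R : R)%:E).

Section frequent_dynamics.
Context {R : realType} {E : normedModType R}.
Implicit Type T : E -> E.

Definition frequently_recurrent_vector T (x : E) :=
  forall U : set E, nbhs x U ->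
    (0 < lower_density R [set n | U (iter n T x)])%E.

Definition frequently_recurrent T :=
  dense [set x : E | frequently_recurrent_vector T x].

Definition frequently_hypercyclic T :=
  exists x : E, forall U : set E, open U -> U !=set0 ->
    (0 < lower_density R [set n | U (iter n T x)])%E.

End frequent_dynamics.

Lemma esumZ_le (R : realType) (I : choiceType) (c : R) (f : I -> R) :
  0 <= c -> (forall i, 0 <= f i) ->
  (\esum_(i in [set: I]) (c * f i)%:E <=
   c%:E * \esum_(i in [set: I]) (f i)%:E)%E.
Proof.
move=> c0 f0; apply: ge_ereal_sup => _ [A [finA _] <-].
under eq_fsbigr do rewrite EFinM.
rewrite -ge0_mule_fsumr; last by move=> i; rewrite lee_fin.
apply: lee_wpmul2l; first by rewrite lee_fin.
by apply: ereal_sup_ubound; exists A.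
Qed.

Lemma powRD_le (R : realType) (p a b u v : R) : 1 <= p -> 0 < a -> 0 < b ->
  0 <= u -> 0 <= v ->
  (u + v) `^ p <= (a + b) `^ p * (a / (a + b)) / a `^ p * u `^ p +
                  (a + b) `^ p * (b / (a + b)) / b `^ p * v `^ p.
Proof.
move=> p1 a0 b0 u0 v0.
have ab0 : 0 < a + b by rewrite addr_gt0.
have t0 : 0 <= a / (a + b) by rewrite divr_ge0// ltW.
have t1 : a / (a + b) <= 1 by rewrite ler_pdivrMr// mul1r lerDl ltW.
have cE : 1 - a / (a + b) = b / (a + b) by field; rewrite gt_eqF.
have uvE : a / (a + b) * (u / a) + (1 - a / (a + b)) * (v / b) = (u + v) / (a + b).
  by field; rewrite !gt_eqF.
have : (a / (a + b) * (u / a) + (1 - a / (a + b)) * (v / b)) `^ p <=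
    a / (a + b) * (u / a) `^ p + (1 - a / (a + b)) * (v / b) `^ p.
  by apply: (convex_powR p1 (Itv01 t0 t1));
    rewrite inE/= in_itv/= andbT divr_ge0// ltW.
rewrite uvE cE.
have dP x y : 0 <= x -> 0 < y -> (x / y) `^ p = x `^ p / y `^ p.
  move=> x0 y0; rewrite powRM// ?invr_ge0 ?ltW//; congr (_ * _).
  by rewrite -(powR_inv1 (ltW y0)) -powRrM mulN1r powRN.
rewrite !dP// ?addr_ge0//.
rewrite ler_pdivrMr ?powR_gt0// => /le_trans; apply.
by rewrite le_eqVlt; apply/orP; left; apply/eqP; field; rewrite !gt_eqF// powR_gt0.
Qed.

(* lp p1 V is l^p(Z) with coordinates in V, where p1 : 1 <= p; its norm is
   (\sum_i |x_i|^p)^(1/p). The real space is obtained for V := R^o, and the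
   complex one for V := Rcomplex R, i.e., R[i] with its modulus, regarded as a
   normed space over R: the weights are real, and recurrence and hypercyclicity
   depend on the topology only, which is that of the complex normed space. *)
Section lp_space.
Context {R : realType}.

Definition lp_sum (p : R) (V : normedModType R) (x : int -> V) : \bar R :=
  \esum_(i in [set: int]) (`|x i| `^ p)%:E.

Definition lp_pred (p : R) (p1 : 1 <= p) (V : normedModType R) :
  {pred (int -> V)} := fun x => (lp_sum p x < +oo)%E.
Arguments lp_pred [p] p1 V.

Record lp (p : R) (p1 : 1 <= p) (V : normedModType R) :=
  Lp { lp_val :> int -> V; lp_valP : lp_val \in lp_pred p1 V }.
HB.instance Definition _ p p1 V := [isSub for @lp_val p p1 V].
HB.instance Definition _ p p1 V := [Choice of @lp p p1 V by <:].

Context (p : R) (p1 : 1 <= p) (V : normedModType R).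
Implicit Types x y : int -> V.

Let p_gt0 : 0 < p. Proof. exact: lt_le_trans p1. Qed.
Let p_ge0 : 0 <= p. Proof. exact: ltW. Qed.
Let p_neq0 : p != 0. Proof. by rewrite gt_eqF. Qed.

Lemma lp_sum_ge0 x : (0 <= lp_sum p x)%E.
Proof. by apply: esum_ge0 => i _; rewrite lee_fin powR_ge0. Qed.

Lemma lp_sumZ_le x y (c : R) : 0 <= c ->
  (forall i, `|x i| <= c * `|y i|) ->
  (lp_sum p x <= (c `^ p)%:E * lp_sum p y)%E.
Proof.
move=> c0 xy; apply: (@le_trans _ _
  (\esum_(i in [set: int]) (c `^ p * `|y i| `^ p)%:E)%E); last first.
  by apply: esumZ_le => [|i]; rewrite powR_ge0.
apply: le_esum => i _; rewrite lee_fin -powRM//.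
by rewrite ge0_ler_powR// nnegrE// mulr_ge0.
Qed.

Lemma lp_sumD_le x y (a b : R) : 0 < a -> 0 < b ->
  (lp_sum p x <= (a `^ p)%:E)%E -> (lp_sum p y <= (b `^ p)%:E)%E ->
  (lp_sum p (x + y)%R <= ((a + b) `^ p)%:E)%E.
Proof.
move=> a0 b0 xa yb.
pose c1 := (a + b) `^ p * (a / (a + b)) / a `^ p.
pose c2 := (a + b) `^ p * (b / (a + b)) / b `^ p.
have ab0 : 0 < a + b by rewrite addr_gt0.
have c10 : 0 <= c1 by rewrite !(divr_ge0, mulr_ge0)// ?powR_ge0 ?ltW.
have c20 : 0 <= c2 by rewrite !(divr_ge0, mulr_ge0)// ?powR_ge0 ?ltW.
apply: (@le_trans _ _ (c1%:E * lp_sum p x + c2%:E * lp_sum p y)%E); last first.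
  apply: (@le_trans _ _ (c1%:E * (a `^ p)%:E + c2%:E * (b `^ p)%:E)%E).
    by apply: leeD; apply: lee_wpmul2l; rewrite ?lee_fin.
  rewrite -!EFinM -EFinD lee_fin le_eqVlt; apply/orP; left; apply/eqP.
  by rewrite /c1 /c2; field; rewrite !gt_eqF// powR_gt0.
apply: (@le_trans _ _ (\esum_(i in [set: int])
    ((c1 * `|x i| `^ p)%:E + (c2 * `|y i| `^ p)%:E))%E).
  apply: le_esum => i _; rewrite -EFinD lee_fin.
  apply: le_trans (powRD_le p1 a0 b0 (normr_ge0 _) (normr_ge0 _)).
  by rewrite ge0_ler_powR// ?nnegrE// ?addr_ge0// ler_normD.
rewrite esumD; last 2 first.
  by move=> i _; rewrite lee_fin mulr_ge0// powR_ge0.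
  by move=> i _; rewrite lee_fin mulr_ge0// powR_ge0.
by apply: leeD; apply: esumZ_le => // i; rewrite powR_ge0.
Qed.

Definition lp_norm x : R := fine (lp_sum p x) `^ p^-1.

Lemma lp_norm_le x c : x \in lp_pred p1 V -> 0 <= c ->
  (lp_norm x <= c) = (lp_sum p x <= (c `^ p)%:E)%E.
Proof.
move=> xp c0; rewrite /lp_norm.
have [s [s0 ->]] : exists s : R, 0 <= s /\ lp_sum p x = s%:E.
  exists (fine (lp_sum p x)); rewrite fine_ge0 ?lp_sum_ge0//; split => //.
  by rewrite fineK// ge0_fin_numE ?lp_sum_ge0.
rewrite lee_fin/=; apply/idP/idP => sc.
  have : (s `^ p^-1) `^ p <= c `^ p by rewrite ge0_ler_powR// nnegrE// powR_ge0.
  by rewrite -powRrM mulVf// powRr1.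
have : s `^ p^-1 <= (c `^ p) `^ p^-1.
  by rewrite ge0_ler_powR// ?nnegrE// ?powR_ge0// invr_ge0.
by rewrite -powRrM mulfV// powRr1.
Qed.

Lemma lp_pred_fin x (c : R) : (lp_sum p x <= c%:E)%E -> x \in lp_pred p1 V.
Proof. by move=> xc; apply: le_lt_trans xc (ltry _). Qed.

Lemma lp_norm_ge0 x : 0 <= lp_norm x. Proof. exact: powR_ge0. Qed.

Lemma lp_sum_norm_le x (c : R) : x \in lp_pred p1 V -> lp_norm x <= c ->
  (lp_sum p x <= (c `^ p)%:E)%E.
Proof. by move=> xp xc; rewrite -lp_norm_le// (le_trans (lp_norm_ge0 x)). Qed.

Lemma lp_predD x y : x \in lp_pred p1 V -> y \in lp_pred p1 V ->
  x + y \in lp_pred p1 V.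
Proof.
move=> xp yp.
apply: (@lp_pred_fin _ (((lp_norm x + 1) + (lp_norm y + 1)) `^ p)).
apply: lp_sumD_le; rewrite ?ltr_wpDl ?lp_norm_ge0//.
  by apply: lp_sum_norm_le => //; rewrite lerDl.
by apply: lp_sum_norm_le => //; rewrite lerDl.
Qed.

Lemma lp_predZ_le x y (c : R) : 0 <= c -> y \in lp_pred p1 V ->
  (forall i, `|x i| <= c * `|y i|) -> x \in lp_pred p1 V.
Proof.
move=> c0 yp xy; apply: (le_lt_trans (lp_sumZ_le c0 xy)).
have yfin : lp_sum p y \is a fin_num by rewrite ge0_fin_numE ?lp_sum_ge0.
by rewrite -(fineK yfin) -EFinM ltry.
Qed.

Lemma lp_normZ_le x y (c : R) : 0 <= c -> y \in lp_pred p1 V ->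
  (forall i, `|x i| <= c * `|y i|) -> lp_norm x <= c * lp_norm y.
Proof.
move=> c0 yp xy; rewrite lp_norm_le; last 2 first.
- exact: lp_predZ_le xy.
- by rewrite mulr_ge0// lp_norm_ge0.
apply: (le_trans (lp_sumZ_le c0 xy)); rewrite powRM ?lp_norm_ge0// EFinM.
by apply: lee_wpmul2l; rewrite ?lee_fin ?powR_ge0// lp_sum_norm_le.
Qed.

Lemma lp_submod_closed : submod_closed (lp_pred p1 V).
Proof.
split.
  apply: (@lp_pred_fin _ 0); rewrite /lp_sum esum1// => i _.
  by rewrite normr0 powR0.
move=> a x y xp yp; apply: lp_predD => //.
by apply: (@lp_predZ_le _ x `|a|) => // i; rewrite normrZ.
Qed.

HB.instance Definition _ :=
  GRing.isSubmodClosed.Build R (int -> V) (lp_pred p1 V) lp_submod_closed.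
HB.instance Definition _ := [SubChoice_isSubLmodule of lp p1 V by <:].

Let ler_lp_normD (x y : lp p1 V) : lp_norm (x + y) <= lp_norm x + lp_norm y.
Proof.
apply/ler_addgt0Pr => e e0.
have -> : lp_norm x + lp_norm y + e = (lp_norm x + e / 2) + (lp_norm y + e / 2).
  by rewrite addrACA -splitr.
have e20 : 0 < e / 2 by rewrite divr_gt0.
rewrite lp_norm_le ?lp_valP ?addr_ge0 ?lp_norm_ge0 ?(ltW e20)//.
apply: lp_sumD_le; rewrite ?ltr_wpDl ?lp_norm_ge0//.
  by apply: lp_sum_norm_le; rewrite ?lp_valP// lerDl ltW.
by apply: lp_sum_norm_le; rewrite ?lp_valP// lerDl ltW.
Qed.

Let lp_normZ (a : R) (x : lp p1 V) : lp_norm (a *: x) = `|a| * lp_norm x.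
Proof.
have le (b : R) (y : lp p1 V) : lp_norm (b *: y) <= `|b| * lp_norm y.
  by apply: lp_normZ_le; rewrite ?lp_valP// => i; rewrite normrZ.
apply/eqP; rewrite eq_le le/=; have [->|a0] := eqVneq a 0.
  by rewrite normr0 mul0r lp_norm_ge0.
have {1}-> : x = a^-1 *: (a *: x) by rewrite scalerA mulVf// scale1r.
by rewrite -ler_pdivlMl ?normr_gt0// -normfV le.
Qed.

Let lp_norm_eq0 (x : lp p1 V) : lp_norm x = 0 -> x = 0.
Proof.
move=> x0; apply/val_inj/funext => i /=.
have : (lp_sum p x <= (0 `^ p)%:E)%E by rewrite -lp_norm_le ?lp_valP ?x0.
rewrite powR0// => sx0; apply/normr0_eq0/(@powR_eq0_eq0 _ _ p)/eqP.
rewrite eq_le powR_ge0 andbT -lee_fin; apply: le_trans sx0.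
by apply: esum_ge; exists [set i]; [split|rewrite fsbig_set1].
Qed.

HB.instance Definition _ := Lmodule_isNormed.Build R (lp p1 V)
  ler_lp_normD lp_normZ lp_norm_eq0.

Lemma lp_normE (x : lp p1 V) : `|x| = lp_norm x. Proof. by []. Qed.

End lp_space.
Arguments lp_pred {R} [p] p1 V.

Section weighted_backward_shift.
Context {R : realType}.

Definition wshift_seq (V : normedModType R) (w : int -> R) (x : int -> V) :
  int -> V := fun i => w (i + 1) *: x (i + 1).

Context (p : R) (p1 : 1 <= p) (V : normedModType R).
Context (w : int -> R) (w_bnd : bounded_fun w).

Let w_bound : exists2 M : R, 0 <= M & forall i, `|w i| <= M.
Proof.
have gP : ProperFilter (globally [set: int]) by exact: (@globally_properfilter _ _ 0).
have [M wM] := (@ex_bound _ _ _ (w : int -> R^o) _ gP).1 w_bnd.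
by exists M => [|i]; [exact: le_trans (wM 0 I)|exact: wM].
Qed.

Lemma lp_sum_shift (x : int -> V) :
  lp_sum p (fun i => x (i + 1)) = lp_sum p x.
Proof.
rewrite /lp_sum [RHS](@reindex_esum _ _ _ [set: int] _ (fun i => i + 1))//.
split; [by []|by move=> i j _ _; apply: addIr|].
by move=> i _; exists (i - 1) => //; rewrite subrK.
Qed.

Lemma wshift_subproof (x : lp p1 V) : wshift_seq w x \in lp_pred p1 V.
Proof.
have [M M0 wM] := w_bound.
apply: (@lp_predZ_le _ _ p1 _ _ (fun i => x (i + 1)) M) => //.
  by have := lp_valP x; rewrite !unfold_in /lp_pred lp_sum_shift.
by move=> i; rewrite normrZ ler_wpM2r.
Qed.

(* Boundedness of w is what makes the shift an endomorphism of lp. *)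
Definition wshift (x : lp p1 V) : lp p1 V := Lp (wshift_subproof x).

Lemma wshiftE (x : lp p1 V) i : wshift x i = w (i + 1) *: x (i + 1).
Proof. by []. Qed.

Let wshift_linear : linear wshift.
Proof.
move=> a x y; apply/val_inj/funext => i.
rewrite -[LHS]/(w (i + 1) *: (a *: x (i + 1) + y (i + 1))).
rewrite -[RHS]/(a *: (w (i + 1) *: x (i + 1)) + w (i + 1) *: y (i + 1)).
by rewrite scalerDr !scalerA mulrC.
Qed.

HB.instance Definition _ :=
  GRing.isLinear.Build R (lp p1 V) (lp p1 V) *:%R wshift wshift_linear.

Lemma wshift_continuous : continuous wshift.
Proof.
apply: (@bounded_linear_continuous _ _ _ wshift); apply/bounded_funP => r.
have [M M0 wM] := w_bound.
exists (M * r) => x xr; apply: (@le_trans _ _ (M * `|x|)); last first.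
  by rewrite ler_wpM2l.
have -> : `|x| = lp_norm p (fun i => x (i + 1)).
  by rewrite lp_normE /lp_norm lp_sum_shift.
apply: (lp_normZ_le (p1 := p1)) => //.
  by have := lp_valP x; rewrite !unfold_in /lp_pred lp_sum_shift.
by move=> i; rewrite normrZ ler_wpM2r.
Qed.

End weighted_backward_shift.
Arguments wshift {R} [p] p1 V [w] w_bnd x.

Section Rcomplex_normedModType.
Variable R : realType.

Let normcZ (a : R) (z : Rcomplex R) : `|a *: z| = `|a| * `|z|.
Proof.
case: z => x y.
rewrite -[LHS]/(Num.sqrt ((a * x) ^+ 2 + (a * y) ^+ 2)).
rewrite -[RHS]/(`|a| * Num.sqrt (x ^+ 2 + y ^+ 2)).
by rewrite !exprMn -mulrDr sqrtrM ?sqr_ge0// sqrtr_sqr.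
Qed.

HB.instance Definition _ :=
  PseudoMetric.copy (Rcomplex R) (pseudoMetric_normed (Rcomplex R)).
HB.instance Definition _ := isPointed.Build (Rcomplex R) 0.
HB.instance Definition _ :=
  NormedZmod_PseudoMetric_eq.Build R (Rcomplex R) erefl.
HB.instance Definition _ :=
  PseudoMetricNormedZmod_Lmodule_isNormedModule.Build R (Rcomplex R) normcZ.

End Rcomplex_normedModType.

(* Main.v *)
(* Let a be the positive solution of a_i = w_(i+1) a_(i+1) with a_0 = 1. Writing
   x_i = a_i y_i turns B_w into the unweighted shift of y on l^p(Z, a^p). Both
   properties of B_w are equivalent to the summability of a^p over Z.

   Recurrence implies summability. Let x be frequently recurrent with x_0 away
   from 0, and let A be the set of return times to a small ball around x. For
   n in A the norm of B^n x is bounded and |y_m| is bounded below for m in A, so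
   sum_(m in A) a_(m-n)^p is bounded uniformly in n in A. As a_i <= M a_(i+1),
   this remains true, with a larger bound, for n in D_L = A + [0, L]. The density
   of D_L increases with L, so for some L it can only grow by a small amount when
   L is replaced by any L + K; this forces D_L to meet every translate A - i in a
   set of density bounded below independently of i, and averaging over n in D_L
   bounds sum_i a_i^p.

   Summability implies frequent hypercyclicity. Choose h increasing to infinity
   with sum_i h(|i|) a_i^p finite. Place around the m-th centre, where the
   spacings are of the order of v_2(m) and hence bounded on average, a finite
   block that depends only on v = v_2(m), has radius at most v and entries of
   size at most h(v)^(1/p). Seen from any centre, the entry at distance k outside
   of the central block has size at most h(k)^(1/p), so the tails are small. The
   blocks enumerate all finite sequences from a countable dense set, each of them
   for infinitely many v, and the m with v_2(m) = v have positive density. *)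
Require Import Defs.
From HB Require Import structures.
From mathcomp Require Import all_boot all_order all_algebra.
From mathcomp Require Import complex.
From mathcomp Require Import all_classical all_reals all_analysis.
From mathcomp Require Import zify lra ring.
Set Implicit Arguments.
Unset Strict Implicit.
Unset Printing Implicit Defensive.
Import Order.TTheory GRing.Theory Num.Theory.
Import numFieldNormedType.Exports.
Local Open Scope classical_set_scope.
Local Open Scope ring_scope.

(** * Counting in [1, N] *)

Definition cnt (P : int -> bool) (N : nat) := count (fun n : nat => P n) (iota 1 N).

Lemma cntS P N : cnt P N.+1 = (cnt P N + P N.+1)%N.
Proof. by rewrite /cnt -{1}[N.+1]addn1 iotaD count_cat/= add1n addn0. Qed.

Lemma cnt_sub (P Q : int -> bool) N : (forall n, P n -> Q n) ->
  (cnt P N <= cnt Q N)%N.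
Proof. by move=> PQ; apply: sub_count => n; apply: PQ. Qed.

Lemma cnt_le P N : (cnt P N <= N)%N.
Proof. by rewrite (leq_trans (count_size _ _))// size_iota. Qed.

Lemma cntUI (P Q : int -> bool) N :
  (cnt (fun n => P n || Q n) N + cnt (fun n => P n && Q n) N =
   cnt P N + cnt Q N)%N.
Proof. exact: count_predUI. Qed.

Lemma cnt_shift1 (P : int -> bool) N :
  (cnt (fun n => P (n + 1)%R) N + P 1 = cnt P N + P N.+1)%N.
Proof.
elim: N => [//|N IH]; rewrite !cntS addnAC IH.
by have -> : N.+1%:Z + 1 = N.+2 by lia.
Qed.

Lemma cnt_shift (P : int -> bool) (i : int) N :
  (cnt (fun n => P (n + i)%R) N <= cnt P N + `|i|)%N.
Proof.
have up (k : nat) (Q : int -> bool) :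
    (cnt (fun n => Q (n + k%:Z)%R) N <= cnt Q N + k)%N /\
    (cnt Q N <= cnt (fun n => Q (n + k%:Z)%R) N + k)%N.
  elim: k => [|k [IH1 IH2]].
    rewrite !addn0; split; apply: cnt_sub => n; by rewrite addr0.
  have := cnt_shift1 (fun n => Q (n + k%:Z)) N.
  have -> : cnt (fun n => Q (n + 1 + k%:Z)) N = cnt (fun n => Q (n + k.+1%:Z)) N.
    by apply: eq_count => n /=; congr Q; lia.
  by lia.
case: i => k; first by have [] := up k P.
have [_] := up k.+1 (fun n => P (n + Negz k)).
have -> : cnt (fun n => P (n + k.+1%:Z + Negz k)) N = cnt P N.
  by apply: eq_count => n /=; congr P; lia.
by rewrite NegzE abszN.
Qed.

(* Otherwise, [u] would grow by more than [N / q] at each of [q + 1] successive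
   levels [L], for all large [N]. *)
Lemma slow_growth (u : nat -> nat -> nat) (q : nat) :
  (forall L N, (u L N <= N)%N) ->
  exists L, forall K N1, exists2 N, (N1 <= N)%N &
    (q * u (L + K) N <= q * u L N + N)%N.
Proof.
move=> uN; apply: contrapT => /forallNP H.
suff /(_ q.+1)[L [N1 /(_ N1.+1 (leqnSn _))]] : forall i, exists L N1, forall N,
    (N1 <= N)%N -> (i * N <= q * u L N)%N.
  by have := leq_mul (leqnn q) (uN L N1.+1); lia.
elim=> [|i [L [N1 iN]]]; first by exists 0%N, 0%N.
have /existsNP[K /existsNP[N2 /forall2NP N2P]] := H L.
exists (L + K)%N, (maxn N1 N2) => N; rewrite geq_max => /andP[/iN N1N N2N].
by have [/(_ N2N)//|/negP] := N2P N; lia.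
Qed.

(** * Sums over the windows [-K, K) *)

Definition wsum (R : pzRingType) (f : int -> R) (K : nat) : R :=
  \sum_(k < K) (f (Posz k) + f (Negz k)).

Section wsum.
Variable R : numDomainType.
Implicit Types f g : int -> R.

Lemma wsumS f K : wsum f K.+1 = wsum f K + (f (Posz K) + f (Negz K)).
Proof. by rewrite /wsum big_ord_recr. Qed.

(* [wsum f K] sums f over the i with [radz i < K]; [radz i] is the absolute value
   for i >= 0 but one less for i < 0. *)
Definition radz (i : int) : nat := match i with Posz k => k | Negz k => k end.

Lemma le_wsum f g K : (forall i, (radz i < K)%N -> f i <= g i) ->
  wsum f K <= wsum g K.
Proof. by move=> fg; apply: ler_sum => k _; apply: lerD; apply: fg => /=. Qed.

Lemma wsum_ge0 f K : (forall i, 0 <= f i) -> 0 <= wsum f K.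
Proof. by move=> f0; apply: sumr_ge0 => k _; rewrite addr_ge0. Qed.

Lemma wsumM a f K : wsum (fun i => a * f i) K = a * wsum f K.
Proof. by rewrite /wsum mulr_sumr; apply: eq_bigr => k _; rewrite mulrDr. Qed.

Lemma wsumD f g K : wsum (fun i => f i + g i) K = wsum f K + wsum g K.
Proof. by rewrite /wsum -big_split; apply: eq_bigr => k _; rewrite addrACA. Qed.

Lemma wsum_nat (I : Type) (r : seq I) (P : pred I) (f : I -> int -> R) K :
  \sum_(n <- r | P n) wsum (f n) K = wsum (fun i => \sum_(n <- r | P n) f n i) K.
Proof.
by rewrite /wsum exchange_big/=; apply: eq_bigr => k _; rewrite big_split.
Qed.

Lemma wsum_shift f K : (forall i, 0 <= f i) ->
  wsum (fun i => f (i + 1)) K <= wsum f K.+1.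
Proof.
(* Both sides of [E] are the sum of [f] over [-K, K]. *)
move=> f0; suff E : wsum (fun i => f (i + 1)) K + f (- K%:Z) = wsum f K + f K.
  by rewrite wsumS addrA -E -addrA lerDl addr_ge0.
elim: K => [|K IH]; first by rewrite /wsum !big_ord0 oppr0.
rewrite !wsumS NegzE.
have -> : - K.+1%:Z + 1 = - K%:Z by lia.
have -> : K%:Z + 1 = K.+1%:Z by lia.
by rewrite [f K.+1%:Z + _]addrC !addrA IH; ring.
Qed.

End wsum.

(** * Summability from a set of return times *)

(* The indicator of A + [0, L], where chi is that of A. *)
Definition fatten (chi : int -> bool) (L : nat) (n : int) : bool :=
  [exists j : 'I_L.+1, chi (n - j%:Z)].

Lemma fattenP (chi : int -> bool) L n :
  reflect (exists2 j : nat, (j <= L)%N & chi (n - j%:Z)) (fatten chi L n).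
Proof.
apply: (iffP existsP) => [[j cj]|[j jL cj]]; first by exists j; rewrite // -ltnS.
by exists (Ordinal (jL : (j < L.+1)%N)).
Qed.

(** By inclusion-exclusion. Up to boundary terms of at most K each, A - i has at least N / q
    elements, and its union with D_L fits, after a translation, into D_(L+K), which exceeds D_L by
    at most N / (2q). What remains is N / q - N / (2q) - 2K >= N / (4q). *)
Lemma cnt_fatten_shift (chi : int -> bool) (q L K N : nat) (i : int) :
  (N <= q * cnt chi N)%N -> (8 * q * K <= N)%N -> (`|i| <= K)%N ->
  (2 * q * cnt (fatten chi (L + K)) N <= 2 * q * cnt (fatten chi L) N + N)%N ->
  (N <= 4 * q * cnt (fun n => chi (n + i)%R && fatten chi L n) N)%N.
Proof.
move=> qA KN iK qD.
have UI := cntUI (fun n => chi (n + i)) (fatten chi L) N.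
have chi_i : (cnt chi N <= cnt (fun n => chi (n + i)%R) N + K)%N.
  apply: leq_trans (leq_add (leqnn _) iK); rewrite -[`|i|%N]abszN.
  apply: leq_trans (cnt_shift (fun n => chi (n + i)) (- i) N).
  by apply: cnt_sub => n; rewrite subrK.
(* Translation by the positive part of i moves both sets into D_(L+K). *)
pose s : int := Num.max i 0.
have sK : (`|s| <= K)%N by rewrite /s; lia.
have U : (cnt (fun n => chi (n + i)%R || fatten chi L n) N <=
    cnt (fatten chi (L + K)) N + K)%N.
  apply: leq_trans (leq_add (leqnn _) sK).
  apply: leq_trans (cnt_shift (fatten chi (L + K)) s N); apply: cnt_sub => n.
  case/orP => [ci|/fattenP[j jL cj]]; apply/fattenP.
    exists `|s - i|%N; first by rewrite /s; lia.
    by have -> : n + s - `|s - i|%N%:Z = n + i by rewrite /s; lia.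
  exists (j + `|s|)%N; first by lia.
  by have -> : n + s - (j + `|s|)%N%:Z = n - j%:Z by rewrite /s; lia.
move: UI chi_i U; set I := cnt (fun n => _ && _) N; set U := cnt (fun n => _ || _) N.
move=> UI chi_i U'.
have /(leq_mul (leqnn (2 * q))) : (cnt chi N + cnt (fatten chi L) N <=
  I + cnt (fatten chi (L + K)) N + 2 * K)%N by lia.
by nia.
Qed.

Lemma cntI (R : pzSemiRingType) (P Q : int -> bool) N :
  (cnt (fun n => P n && Q n) N)%:R = \sum_(n <- iota 1 N | Q n) (P n)%:R :> R.
Proof.
rewrite /cnt -sum1_count natr_sum big_mkcond [RHS]big_mkcond/=.
by apply: eq_bigr => n _; case: (P n); case: (Q n).
Qed.

Section summability.
Variables (R : realFieldType) (b : int -> R) (M C : R) (chi : int -> bool).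
Hypotheses (b_ge0 : forall i, 0 <= b i) (M_ge0 : 0 <= M) (C_ge0 : 0 <= C).
Hypothesis bM : forall i, b i <= M * b (i + 1).
Hypothesis bC : forall n K, chi n -> wsum (fun i => (chi (n + i))%:R * b i) K <= C.

Let chib_ge0 n i : 0 <= (chi (n + i))%:R * b i.
Proof. by rewrite mulr_ge0. Qed.

(** Moving n by 1 costs a factor M, by [bM] after reindexing the sum. The base 1 + M >= 1 lets one
    bound serve all j <= L. *)
Lemma wsum_fatten L n K : fatten chi L n ->
  wsum (fun i => (chi (n + i))%:R * b i) K <= (1 + M) ^+ L * C.
Proof.
have step n' K' : wsum (fun i => (chi (n' + 1 + i))%:R * b i) K' <=
    M * wsum (fun i => (chi (n' + i))%:R * b i) K'.+1.
  apply: (@le_trans _ _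
    (wsum (fun i => M * ((chi (n' + (i + 1)))%:R * b (i + 1))) K')).
    apply: le_wsum => i _; rewrite addrAC -addrA mulrCA.
    by rewrite ler_wpM2l.
  rewrite wsumM ler_wpM2l//.
  exact: (@wsum_shift _ (fun i => (chi (n' + i))%:R * b i)).
have shift j n' K' : chi n' ->
    wsum (fun i => (chi (n' + j%:Z + i))%:R * b i) K' <= (1 + M) ^+ j * C.
  move=> cn'; elim: j K' => [|j IH] K'; first by rewrite expr0 mul1r addr0 bC.
  have -> : n' + j.+1%:Z = n' + j%:Z + 1 by lia.
  apply: le_trans (step _ _) _; apply: le_trans (ler_wpM2l M_ge0 (IH _)) _.
  by rewrite exprS -mulrA ler_wpM2r ?lerDr// mulr_ge0// exprn_ge0// addr_ge0.
case/fattenP => j jL cj.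
rewrite -[n](subrK j%:Z); apply: le_trans (shift _ _ _ cj) _.
by rewrite ler_wpM2r// ler_weXn2l// lerDl.
Qed.

(** Double counting of the pairs (n, i) with n in D_L and n + i in A, weighted by b_i: every i of
    the window has at least N / (4q) partners n, while every n contributes at most (1 + M)^L C. *)
Lemma return_set_summable (q N0 : nat) :
  (forall N, (N0 <= N)%N -> (N <= q * cnt chi N)%N) ->
  exists S, forall K, wsum b K <= S.
Proof.
move=> dens.
(* With 2q, the growth is at most half of the lower bound 1 / q on the density of A. [L] is fixed
   before the window size [K], so the final bound does not depend on [K]. *)
have [L HL] := @slow_growth (fun L N => cnt (fatten chi L) N) (2 * q)
  (fun L N => cnt_le _ _).
exists ((4 * q)%:R * ((1 + M) ^+ L * C)) => K.
have [N NN1 slow] := HL K.+1 (maxn N0 (8 * q * K.+1).+1).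
have [N0N KN] : (N0 <= N)%N /\ (8 * q * K.+1 < N)%N by lia.
have Ngt0 : 0 < N%:R :> R by rewrite ltr0n; lia.
rewrite -(ler_pM2l Ngt0).
apply: (@le_trans _ _ (wsum (fun i =>
    (4 * q * cnt (fun n => chi (n + i)%R && fatten chi L n) N)%:R * b i) K)).
  rewrite -wsumM; apply: le_wsum => i iK.
  rewrite ler_wpM2r// ler_nat; apply: (@cnt_fatten_shift _ _ _ K.+1) => //.
  - exact: dens.
  - exact: ltnW.
  - by case: i iK => k /=; lia.
have -> : wsum (fun i =>
    (4 * q * cnt (fun n => chi (n + i)%R && fatten chi L n) N)%:R * b i) K =
    (4 * q)%:R * \sum_(n <- iota 1 N | fatten chi L n)
      wsum (fun i => (chi (n%:Z + i))%:R * b i) K.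
  rewrite wsum_nat -wsumM /wsum; apply: eq_bigr => k _.
  by congr +%R; rewrite natrM -mulrA -mulr_suml cntI.
rewrite mulrCA ler_wpM2l//.
apply: (@le_trans _ _ (\sum_(n <- iota 1 N | fatten chi L n) ((1 + M) ^+ L * C))).
  by apply: ler_sum => n nD; apply: wsum_fatten.
rewrite big_const_seq iter_addr_0 -[_ *+ count _ _]mulr_natl ler_wpM2r ?ler_nat//.
  by rewrite mulr_ge0// exprn_ge0// addr_ge0.
exact: (cnt_le (fatten chi L)).
Qed.

End summability.

(** * Tails of a convergent series *)

Section tails.
Variables (R : realType) (f : int -> R) (S : R).
Hypothesis fS : forall K, wsum f K <= S.

Let sup_wsum : has_sup (range (wsum f)).
Proof. by split; [exists (wsum f 0), 0%N|exists S => _ [K _ <-]]. Qed.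

Lemma wsum_le_sup K : wsum f K <= sup (range (wsum f)).
Proof. by apply: (sup_upper_bound sup_wsum); exists K. Qed.

Lemma wsum_near_sup e : 0 < e -> exists K, sup (range (wsum f)) - e < wsum f K.
Proof. by move=> e0; have [_ [K _ <-] eK] := sup_adherent e0 sup_wsum; exists K. Qed.

Lemma wsum_tail e : 0 < e -> exists K0, forall K,
  wsum (fun i => (K0 <= radz i)%N%:R * f i) K <= e.
Proof.
move=> /wsum_near_sup[K0 K0e]; exists K0 => K.
suff E : wsum (fun i => (K0 <= radz i)%N%:R * f i) K =
    wsum f (maxn K K0) - wsum f K0.
  by rewrite E; have := wsum_le_sup (maxn K K0); lra.
elim: K => [|K IH]; first by rewrite max0n subrr /wsum big_ord0.
rewrite wsumS IH /=; have [K0K|KK0] := leqP K0 K.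
  by rewrite !mul1r (maxn_idPl (leqW K0K)) wsumS; ring.
by rewrite !mul0r (maxn_idPr KK0) !addr0.
Qed.

End tails.

(* [h k] is [T_k ^ (- 1/2)], where [T_k] is the tail of the series: as
   [(T_k - T_(k+1)) / sqrt T_k <= 2 (sqrt T_k - sqrt T_(k+1))], the weighted series
   is bounded by a telescoping sum. *)
Lemma slow_weight (R : realType) (b : int -> R) (S : R) :
  (forall i, 0 < b i) -> (forall K, wsum b K <= S) ->
  exists h : nat -> R, [/\ forall k, 0 <= h k,
    {homo h : k l / (k <= l)%N >-> k <= l},
    forall x, exists k, x <= h k &
    exists S', forall K, wsum (fun i => h (radz i) * b i) K <= S'].
Proof.
move=> b0 bS; pose T K := sup (range (wsum b)) - wsum b K.
have TS K : T K = T K.+1 + (b (Posz K) + b (Negz K)) by rewrite /T wsumS; ring.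
have T0 K : 0 < T K.
  rewrite TS ltr_wpDl ?addr_gt0// subr_ge0; exact: wsum_le_sup.
have Tmon K : Num.sqrt (T K.+1) <= Num.sqrt (T K).
  by rewrite ler_wsqrtr// (TS K) lerDl addr_ge0 ?ltW.
have sT0 K : 0 < Num.sqrt (T K) by rewrite sqrtr_gt0.
exists (fun k => (Num.sqrt (T k))^-1); split.
- by move=> k; rewrite invr_ge0 sqrtr_ge0.
- apply: homo_leq => [x|y x z|k]; [exact: lexx|exact: le_trans|].
  by rewrite lef_pV2 ?posrE.
- move=> x; have x0 : 0 < Num.max x 1 by rewrite lt_max ltr01 orbT.
  have [|K] := wsum_near_sup (f := b) bS (e := (Num.max x 1) ^- 2).
    by rewrite invr_gt0 exprn_gt0.
  rewrite ltrBlDr -ltrBlDl -/(T K) => TK; exists K.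
  apply: (@le_trans _ _ (Num.max x 1)); first by rewrite le_max lexx.
  rewrite -[leLHS]invrK lef_pV2 ?posrE ?invr_gt0//.
  rewrite -[leRHS](ger0_norm (x := (Num.max x 1)^-1)) ?invr_ge0 ?(ltW x0)//.
  by rewrite -sqrtr_sqr ler_wsqrtr// exprVn ltW.
exists (2 * Num.sqrt (T 0%N)) => K.
suff : wsum (fun i => (Num.sqrt (T (radz i)))^-1 * b i) K <=
    2 * Num.sqrt (T 0%N) - 2 * Num.sqrt (T K).
  by move=> /le_trans; apply; rewrite gerBl mulr_ge0// sqrtr_ge0.
elim: K => [|K IH]; first by rewrite /wsum big_ord0 subrr.
rewrite wsumS /= -mulrDr.
suff : (Num.sqrt (T K))^-1 * (b K + b (Negz K)) <=
    2 * Num.sqrt (T K) - 2 * Num.sqrt (T K.+1) by lra.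
have -> : b K + b (Negz K) = Num.sqrt (T K) ^+ 2 - Num.sqrt (T K.+1) ^+ 2.
  by rewrite !sqr_sqrtr ?ltW// (TS K); ring.
by rewrite ler_pdivrMl//; have := sqr_ge0 (Num.sqrt (T K) - Num.sqrt (T K.+1)); nra.
Qed.

(** * Placement of the blocks *)

Definition centre (m : nat) : nat :=
  (\sum_(i < m) 2 * (logn 2 i + logn 2 i.+1 + 1))%N.

Lemma centreS m : centre m.+1 = (centre m + 2 * (logn 2 m + logn 2 m.+1 + 1))%N.
Proof. by rewrite /centre big_ord_recr. Qed.

Lemma centre_gap m m' : (m < m')%N ->
  (centre m + 2 * (logn 2 m + logn 2 m' + 1) <= centre m')%N.
Proof.
elim: m' => [//|m' IH]; rewrite ltnS leq_eqVlt centreS => /predU1P[->//|/IH].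
lia.
Qed.

Lemma centre_lt m m' : (m < m')%N -> (centre m < centre m')%N.
Proof. by move=> /centre_gap; lia. Qed.

(** By Legendre's formula, the sum being the 2-adic valuation of m!. *)
Lemma sum_logn2 m : (\sum_(i < m) logn 2 i.+1 <= m)%N.
Proof.
have -> : (\sum_(i < m) logn 2 i.+1)%N = logn 2 m`!.
  elim: m => [|m IH]; first by rewrite big_ord0.
  by rewrite big_ord_recr factS/= lognM ?fact_gt0// IH addnC.
rewrite logn_fact//.
(* The spare term m / 2^k covers both the next summand and the next spare term. *)
suff H k : (\sum_(1 <= i < k.+1) m %/ 2 ^ i + m %/ 2 ^ k <= m)%N.
  exact: leq_trans (leq_addr _ _) (H m).
elim: k => [|k IH]; first by rewrite big_geq// divn1.
rewrite big_nat_recr//= expnSr divnMA -addnA; lia.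
Qed.

Lemma centre_le m : (centre m <= 6 * m)%N.
Proof.
(* Each valuation enters the two adjacent gaps, except that of m, which enters only one so far. *)
suff E : (centre m + 2 * logn 2 m = 4 * \sum_(i < m) logn 2 i.+1 + 2 * m)%N.
  by have := sum_logn2 m; lia.
elim: m => [|m IH]; first by rewrite /centre !big_ord0.
rewrite centreS big_ord_recr/=; move: IH; move: (centre m) (logn 2 m) (logn 2 m.+1).
by move: (\sum_(i < m) _)%N => s c v v'; lia.
Qed.

Lemma sparse_blocks (R : numDomainType) (V : nmodType) (G : V -> R)
    (h : nat -> R) (Z : nat -> int -> V) :
  G 0 = 0 -> (forall k, 0 <= h k) -> {homo h : k l / (k <= l)%N >-> k <= l} ->
  (forall v i, G (Z v i) <= h v) ->
  exists y : int -> V, forall m (i : int),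
    ((`|i| <= logn 2 m)%N -> y ((centre m)%:Z + i) = Z (logn 2 m) i) /\
    ((logn 2 m < `|i|)%N -> G (y ((centre m)%:Z + i)) <= h (radz i)).
Proof.
move=> G0 h0 hmon ZG.
pose near j m := (`|j - (centre m)%:Z| <= logn 2 m)%N.
(* The factor 2 in [centre] serves here: a point of block m is not only outside block m', but also
   farther from the centre of m' than the radius of its own block. Monotonicity of [h] then bounds
   its entry by [h] at that distance. *)
have near_dist j m m' : m <> m' -> near j m ->
    (logn 2 m < radz (j - (centre m')%:Z))%N /\
    (logn 2 m' < `|j - (centre m')%:Z|)%N.
  move=> /eqP; rewrite neq_ltn /near => /orP[/centre_gap|/centre_gap] gap jm.
    split; last by lia.
    by case E : (j - _) => [k|k] /=; lia.
  split; last by lia.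
  by case E : (j - _) => [k|k] /=; lia.
pose y j := if pselect (exists m, near j m) is left e
  then Z (logn 2 (projT1 (cid e))) (j - (centre (projT1 (cid e)))%:Z) else 0.
exists y => m i; split => im.
  rewrite /y; case: pselect => [e|[]]; last first.
    by exists m; rewrite /near addrC addKr.
  case: cid => m' /= m'P.
  have [->|/eqP mm'] := eqVneq m' m; first by rewrite addrC addKr.
  by have [_] := near_dist _ _ _ mm' m'P; rewrite addrC addKr; lia.
rewrite /y; case: pselect => [e|_]; last by rewrite G0.
case: cid => m' /= m'P.
have mm' : m' <> m.
  by move=> E; move: m'P; rewrite /near E addrC addKr; lia.
apply: le_trans (ZG _ _) _; apply: hmon.
by have [+ _] := near_dist _ _ _ mm' m'P; rewrite addrC addKr; lia.
Qed.

(** * Positive lower density *)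

Lemma lower_density_gt0P (R : realType) (A : set nat) :
  (0 < lower_density R A)%E <->
  exists q N0, forall N, (N0 <= N)%N ->
    (N <= q * count (fun n => n \in A) (iota 1 N))%N.
Proof.
rewrite /lower_density limn_einf_lim (cvg_lim _ (@cvg_einfs_sup _ _))//.
pose d N : \bar R := ((count (fun n => n \in A) (iota 1 N))%:R / N%:R : R)%:E.
rewrite -/d.
split.
  move=> /ereal_sup_gt[_ [N0 _ <-]] /=.
  rewrite /einfs/= => inf_gt0.
  have [e e0 einf] : exists2 e : R, 0 < e & (e%:E <= ereal_inf (sdrop d N0))%E.
    move: inf_gt0; case: (ereal_inf _) => [r r0|_|//].
      by exists r; [rewrite -lte_fin|exact: lexx].
    by exists 1; [exact: ltr01|rewrite leey].
  have [q qe] : exists q : nat, e^-1 <= q%:R.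
    by exists (Num.bound e^-1); rewrite ltW// archi_boundP// invr_ge0 ltW.
  exists q, N0 => N N0N; case: N N0N => [//|N] N0N.
  rewrite -(ler_nat R) natrM.
  have : (e%:E <= d N.+1)%E.
    by apply: le_trans einf _; apply: ereal_inf_lbound; exists N.+1.
  rewrite lee_fin ler_pdivlMr ?ltr0n// => eN.
  apply: le_trans (ler_pM _ _ qe eN); rewrite ?invr_ge0 ?mulr_ge0 ?(ltW e0)//.
  by rewrite mulrA mulVf ?mul1r// gt_eqF.
(* [q.+1] is invertible whatever q is, and starting at [N0.+1] excludes N = 0. *)
move=> [q [N0 qN]]; apply: (@lt_le_trans _ _ (q.+1%:R^-1)%:E).
  by rewrite lte_fin invr_gt0 ltr0n.
apply: le_trans (ereal_sup_ubound _); last by exists N0.+1.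
rewrite /einfs/=; apply: le_ereal_inf_tmp => _ [N /= N0N <-].
rewrite lee_fin ler_pdivlMr ?ler_pdivrMl ?ltr0n//; last exact: leq_trans N0N.
rewrite -natrM ler_nat (leq_trans (qN N (ltnW N0N)))// leq_mul//.
Qed.

Lemma lower_density_gt0 (R : realType) (A : set nat) (f : nat -> nat) (c : nat) :
  injective f -> (forall t, (0 < f t <= c * t.+1)%N) -> (forall t, A (f t)) ->
  (0 < lower_density R A)%E.
Proof.
move=> finj fc fA; apply/lower_density_gt0P; exists (2 * c.+1)%N, c.+1 => N cN.
(* The [f t] with t < N / (c + 1) are distinct elements of A in [1, N]. The factor 2 in the witness
   absorbs the rounding of this quotient. *)
have : (N %/ c.+1 <= count (fun n => n \in A) (iota 1 N))%N.
  rewrite -size_filter -(size_iota 0 (N %/ c.+1)) -(size_map f).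
  apply: uniq_leq_size; first by rewrite map_inj_uniq ?iota_uniq.
  move=> n /mapP[t]; rewrite mem_iota add0n => /= tN ->.
  rewrite mem_filter mem_iota mem_set//=; have /andP[-> /=] := fc t.
  move=> /leq_ltn_trans; apply; rewrite add1n ltnS.
  rewrite (leq_trans (leq_mul (leqnSn c) tN))//.
  by rewrite mulnC leq_trunc_div.
move=> /(leq_mul (leqnn (2 * c.+1)))/(leq_trans _); apply.
have := divn_eq N c.+1; have := ltn_pmod N (ltn0Sn c).
have : (0 < N %/ c.+1)%N by rewrite divn_gt0.
nia.
Qed.

Lemma lower_density_shift (R : realType) (A : set nat) (m : nat) :
  (0 < lower_density R A)%E ->
  (0 < lower_density R [set n | A (n + m)%N])%E.
Proof.
move=> /lower_density_gt0P[q [N0 qN]]; apply/lower_density_gt0P.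
exists (2 * q)%N, (maxn N0 (2 * q * m)) => N; rewrite geq_max => /andP[N0N qmN].
have : (count (fun n => n \in A) (iota 1 N) <=
    count (fun n => n \in [set n | A (n + m)%N]) (iota 1 N) + m)%N.
  have -> : count (fun n => n \in [set n | A (n + m)%N]) (iota 1 N) =
      count (fun n => n \in A) (iota (m + 1) N).
    rewrite iotaDl count_map; apply: eq_count => n /=.
    by apply/asboolP/asboolP; rewrite /= addnC.
  apply: (@leq_trans (count (fun n => n \in A) (iota 1 (m + N)))).
    by rewrite addnC iotaD count_cat leq_addr.
  rewrite iotaD count_cat addnC addn1 -add1n leq_add2l.
  by rewrite (leq_trans (count_size _ _))// size_iota.
by have := qN N N0N; nia.
Qed.

Lemma lower_density_gt0_sub (R : realType) (A B : set nat) : A `<=` B ->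
  (0 < lower_density R A)%E -> (0 < lower_density R B)%E.
Proof.
move=> AB /lower_density_gt0P[q [N0 qN]]; apply/lower_density_gt0P.
exists q, N0 => N /qN/leq_trans; apply; rewrite leq_mul2l; apply/orP; right.
by apply: sub_count => n /set_mem/AB/mem_set.
Qed.

(** The orbit of a frequently hypercyclic x is dense, and each of its points is frequently
    recurrent: the visits of [iter m T x] to an open set are those of x, translated by m. *)
Lemma hypercyclic_recurrent (R : realType) (E : normedModType R) (T : E -> E) :
  frequently_hypercyclic T -> frequently_recurrent T.
Proof.
move=> [x hx] O O0 Oo.
have /lower_density_gt0P[q [N0 qN]] := hx O Oo O0.
have [m Om] : exists m, O (iter m T x).
  apply: contrapT => /forallNP H; have := qN N0.+1 (leqnSn _).
  rewrite (@eq_count _ _ pred0) ?count_pred0 ?muln0// => n.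
  by apply/negbTE/negP => /set_mem/H.
exists (iter m T x); split => // U /nbhs_interior xU.
have := hx U° (@open_interior _ U).
move=> /(_ (ex_intro _ _ (nbhs_singleton xU)))/(lower_density_shift m).
apply: lower_density_gt0_sub => n /= /interior_subset.
by rewrite iterD.
Qed.

(** * Unordered sums over Z through windows *)

Definition zwindow (K : nat) : seq int :=
  [seq Posz k | k <- iota 0 K] ++ [seq Negz k | k <- iota 0 K].

Lemma mem_zwindow K i : (i \in zwindow K) = (radz i < K)%N.
Proof.
rewrite mem_cat; apply/orP/idP => [[|] /mapP[k]|].
- by rewrite mem_iota => /= kK ->.
- by rewrite mem_iota => /= kK ->.
by case: i => k kK; [left|right]; apply: map_f; rewrite mem_iota.
Qed.

Lemma zwindow_uniq K : uniq (zwindow K).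
Proof.
rewrite cat_uniq !map_inj_uniq ?iota_uniq ?andbT/=; last 2 first.
- by move=> ? ? [].
- by move=> ? ? [].
by apply/hasPn => _ /mapP[k _ ->]; apply/negP => /mapP[].
Qed.

Lemma wsum_zwindow (R : realType) (f : int -> R) K :
  (wsum f K)%:E = (\sum_(i \in [set` zwindow K]) (f i)%:E)%E.
Proof.
rewrite -fsbig_seq ?zwindow_uniq// -sumEFin big_cat/= !big_map -big_split/=.
have <- : index_iota 0 K = iota 0 K by rewrite /index_iota subn0.
by rewrite big_mkord.
Qed.

(** Every finite set of integers lies in a window, so windows suffice in the supremum over finite
    sets. *)
Lemma esum_wsum_leP (R : realType) (f : int -> R) (C : R) :
  (forall i, 0 <= f i) ->
  (\esum_(i in [set: int]) (f i)%:E <= C%:E)%E <-> forall K, wsum f K <= C.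
Proof.
move=> f0; split => [fC K|fC].
  rewrite -lee_fin; apply: le_trans fC; apply: esum_ge.
  by exists [set` zwindow K]; [split=> //; exact: finite_seq|rewrite wsum_zwindow].
apply: ge_ereal_sup => _ [A [finA _] <-].
have [K AK] : exists K, forall i, A i -> (radz i < K)%N.
  move: finA => /finite_seqP[s ->]; exists (\max_(i <- s) radz i).+1 => i si.
  by rewrite ltnS (leq_bigmax_seq (F := radz)).
apply: (@le_trans _ _ (wsum f K)%:E); last by rewrite lee_fin.
rewrite wsum_zwindow; apply: lee_fsum_nneg_subset => //; first exact: finite_seq.
  by move=> i /set_mem/AK; rewrite -mem_zwindow => /mem_set.
by move=> i _; rewrite lee_fin.
Qed.

(** * Coordinates in which the shift is unweighted *)

Section scale.
Variables (R : realType) (w : int -> R).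
Hypothesis w_gt0 : forall k, 0 < w k.

Definition scale (i : int) : R := match i with
  | Posz k => \prod_(j < k) (w j.+1%:Z)^-1
  | Negz k => \prod_(j < k.+1) w (- j%:Z)
  end.

Lemma scale_gt0 i : 0 < scale i.
Proof. by case: i => k; apply: prodr_gt0 => j _; rewrite ?invr_gt0. Qed.

Lemma scale0 : scale 0 = 1. Proof. exact: big_ord0. Qed.

Lemma scaleE i : scale i = w (i + 1) * scale (i + 1).
Proof.
case: i => [k|[|k]].
- have -> : Posz k + 1 = k.+1 by lia.
  by rewrite /scale big_ord_recr/= mulrCA mulfV ?mulr1// gt_eqF.
- by rewrite scale0 mulr1 [LHS]big_ord1 oppr0.
have -> : Negz k.+1 + 1 = Negz k by lia.
by rewrite [LHS]/scale big_ord_recr/= mulrC NegzE.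
Qed.

End scale.

Section lp_coordinates.
Variables (R : realType) (p : R) (p1 : 1 <= p) (V : normedModType R).
Variable w : int -> R.
Hypotheses (w_gt0 : forall k, 0 < w k) (w_bnd : bounded_fun w).

Let p_gt0 : 0 < p. Proof. exact: lt_le_trans p1. Qed.
Let p_ge0 : 0 <= p. Proof. exact: ltW. Qed.

Local Notation B := (wshift p1 V w_bnd).
Local Notation a := (scale w).

Lemma iter_wshiftE n (x : lp p1 V) i :
  iter n B x i = (a i / a (i + n%:Z)) *: x (i + n%:Z).
Proof.
elim: n i => [|n IH] i.
  by rewrite /= addr0 divff ?scale1r// gt_eqF// scale_gt0.
rewrite iterS wshiftE IH scalerA mulrA -scaleE//.
by rewrite -addrA -[1 + _]/(n.+1%:Z).
Qed.

Lemma lp_norm_le_wsum (x : lp p1 V) (c : R) : 0 <= c ->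
  (`|x| <= c) <-> forall K, wsum (fun i => `|x i| `^ p) K <= c `^ p.
Proof.
move=> c0; rewrite lp_normE (lp_norm_le (p1 := p1)) ?lp_valP//.
by apply: esum_wsum_leP => i; exact: powR_ge0.
Qed.

Lemma lp_of_wsum (f : int -> V) (C : R) :
  (forall K, wsum (fun i => `|f i| `^ p) K <= C) -> f \in lp_pred p1 V.
Proof.
move=> fC; apply: (@lp_pred_fin _ p p1 V f C).
by apply/esum_wsum_leP => // i; exact: powR_ge0.
Qed.

Lemma lp_coord_le (x : lp p1 V) i : `|x i| <= `|x|.
Proof.
have [//|xi] := leP `|x i| `|x|.
have /lp_norm_le_wsum -/(_ (normr_ge0 _))/(_ (radz i).+1) := lexx `|x|.
rewrite wsumS leNgt => /negP; case.
apply: (@lt_le_trans _ _ (`|x i| `^ p)).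
  by rewrite gt0_ltr_powR// ?nnegrE.
have ge0 j : 0 <= `|x j| `^ p by exact: powR_ge0.
by rewrite ler_wpDl ?wsum_ge0//; case: i {xi} => k /=; rewrite ?lerDl ?lerDr.
Qed.

End lp_coordinates.

(** Pigeonhole: v0 + 1 distinct codes cannot all be below v0. This gives a block codes as large as
    required. *)
Lemma pickle_unbounded (T : countType) (f : nat -> T) v0 :
  injective f -> exists r, (v0 <= pickle (f r))%N.
Proof.
move=> finj; apply: contrapT => /forallNP H.
have : (size (map (pickle \o f) (iota 0 v0.+1)) <= size (iota 0 v0))%N.
  apply: uniq_leq_size.
    rewrite map_inj_uniq ?iota_uniq// => r s /(pcan_inj pickleK).
    exact: finj.
  by move=> _ /mapP[r _ ->]; rewrite mem_iota /= ltnNge; apply/negP/H.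
by rewrite size_map !size_iota ltnn.
Qed.

(** * The two implications *)

Section shift_dynamics.
Variables (R : realType) (p : R) (p1 : 1 <= p) (V : normedModType R).
Variable w : int -> R.
Hypotheses (w_gt0 : forall k, 0 < w k) (w_bnd : bounded_fun w).

Let p_gt0 : 0 < p. Proof. exact: lt_le_trans p1. Qed.
Let p_ge0 : 0 <= p. Proof. exact: ltW. Qed.

Local Notation B := (wshift p1 V w_bnd).
Local Notation a := (scale w).

Lemma lp_ballE (x y : lp p1 V) (e : R) : ball x e y = (`|x - y| < e) :> Prop.
Proof. by rewrite -ball_normE. Qed.

Lemma recurrent_summable (e : V) : `|e| = 1 -> frequently_recurrent B ->
  exists S, forall K, wsum (fun i => a i `^ p) K <= S.
Proof.
move=> e1 fr.
have a_ge0 i : 0 <= a i by rewrite ltW ?scale_gt0.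
have w_ge0 i : 0 <= w i by exact: ltW.
pose xi (i : int) : V := if i == 0 then e else 0.
have xi_lp : xi \in lp_pred p1 V.
  apply: (@lp_of_wsum _ _ _ _ _ 1) => -[|K]; first by rewrite /wsum big_ord0.
  rewrite /wsum big_ord_recl big1 => [|k _]; rewrite /xi/=.
    by rewrite e1 powR1 normr0 powR0 ?gt_eqF// !addr0.
  by rewrite normr0 powR0 ?gt_eqF// addr0.
have [x [xi_x xr]] : ball (Lp xi_lp) (1 / 2)
    `&` [set x | frequently_recurrent_vector B x] !=set0.
  by apply: fr; [exists (Lp xi_lp); apply: ballxx|exact: ball_open].
have x0 : 1 / 2 <= `|x 0|.
  move: xi_x; rewrite lp_ballE => /ltW/(le_trans (lp_coord_le _ 0)).
  rewrite -[_ 0]/(e - x 0) => ex.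
  by have := ler_normD (e - x 0) (x 0); rewrite subrK e1; lra.
(* As |x_0| >= 1/2, radius 1/4 keeps coordinate 0 of each returning iterate at least 1/4 in norm. *)
have q4 : 0 < 1 / 4 :> R by lra.
have /lower_density_gt0P[q [N0 qN]] := xr _ (nbhsx_ballx x (1 / 4) q4).
set A := [set n | _] in qN.
pose chi (j : int) : bool := if j is Posz n then n \in A else false.
have [M w_le] : exists M : R, forall i, w i <= M.
  have gP : ProperFilter (globally [set: int]).
    by exact: (@globally_properfilter _ _ 0).
  have [M wM] := (@ex_bound _ _ _ (w : int -> R^o) _ gP).1 w_bnd.
  by exists M => i; apply: le_trans (ler_norm _) (wM i I).
have chiP (n : nat) : n \in A -> `|x - iter n B x| < 1 / 4.
  by move=> /set_mem; rewrite /A/= lp_ballE.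
have A_large (n : nat) : n \in A -> 1 / 4 <= `|x n| / a n.
  move=> /chiP/ltW/(le_trans (lp_coord_le _ 0)).
  rewrite -[_ 0]/(x 0 - iter n B x 0) (iter_wshiftE w_gt0) scale0 add0r !div1r.
  move=> xn; have := ler_normD (x 0 - (a n)^-1 *: x n) ((a n)^-1 *: x n).
  rewrite subrK normrZ ger0_norm ?invr_ge0 ?(ltW (scale_gt0 w_gt0 _))//.
  by rewrite [_^-1 * `|x n|]mulrC; lra.
pose C := `|x| + 1 / 4.
have C0 : 0 <= C by rewrite addr_ge0.
(* For n and n + i in A, a_i is at most 4 (a_i / a_(n+i)) |x_(n+i)|, that is, 4 times the norm of
   coordinate i of B^n x; hence the bound (4C)^p. *)
apply: (@return_set_summable _ _ (M `^ p) ((4 * C) `^ p) chi _ _ _ _ _ q N0).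
- by move=> i; exact: powR_ge0.
- exact: powR_ge0.
- exact: powR_ge0.
- move=> i; rewrite (scaleE w_gt0) powRM//.
  rewrite ler_wpM2r ?powR_ge0// ge0_ler_powR ?nnegrE//.
  exact: le_trans (w_ge0 0) (w_le 0).
- case=> [n K nA|//].
  have nC : `|iter n B x| <= C.
    have := ler_normD (x - iter n B x) (- x); rewrite addrAC subrr add0r !normrN.
    by move=> /le_trans; apply; rewrite addrC lerD2l (ltW (chiP _ _)).
  have /(lp_norm_le_wsum _ C0)/(_ K) {}nC := nC.
  rewrite powRM// -ler_pdivrMl ?powR_gt0//.
  apply: le_trans nC; rewrite -wsumM; apply: le_wsum => i _.
  case chi_ni : (chi _); last by rewrite mul0r mulr0 powR_ge0.
  rewrite mul1r (iter_wshiftE w_gt0) normrZ.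
  rewrite -ler_pdivlMl ?invr_gt0 ?powR_gt0// invrK -powRM//.
  rewrite ge0_ler_powR ?nnegrE ?mulr_ge0//.
  rewrite addrC; move: chi_ni; case: (Posz n + i) => // m mA.
  have := A_large m mA.
  rewrite ger0_norm ?divr_ge0// -mulrA [_^-1 * _]mulrC mulrCA => am.
  by rewrite ler_peMr//; lra.
- exact: qN.
Qed.

(* [v] codes two finite lists of indices into [d], for the entries at nonnegative
   and at negative positions. The third component of the code is ignored, so that
   every pair of lists has arbitrarily large codes. *)
Definition block (d : nat -> V) (h : nat -> R) (v : nat) : int -> V :=
  let: (s1, s2, _) := odflt ([::], [::], 0%N)
    (unpickle v : option (seq nat * seq nat * nat)) in
  if \sum_(c <- s1 ++ s2) `|d c| `^ p <= h v then fun i => match i with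
    | Posz k => nth 0 (map d s1) k
    | Negz k => nth 0 (map d s2) k
    end else fun=> 0.

Lemma block_le d h v i : 0 <= h v -> `|block d h v i| `^ p <= h v.
Proof.
have p0 : `|0 : V| `^ p = 0 by rewrite normr0 powR0 ?gt_eqF.
rewrite /block; case: (odflt _ _) => -[s1 s2] _ hv.
case: ifP => [sh|_]; last by rewrite p0.
have le_sum s k : (forall c, c \in s -> c \in s1 ++ s2) ->
    `|nth 0 (map d s) k| `^ p <= h v.
  move=> ss; have [sk|ks] := leqP (size s) k.
    by rewrite nth_default ?size_map// p0.
  rewrite (nth_map 0%N)//; apply: le_trans sh.
  rewrite (big_rem (nth 0%N s k)) ?ss ?mem_nth//= lerDl.
  by apply: sumr_ge0 => c _; exact: powR_ge0.
by case: i => k; apply: le_sum => c cs; rewrite mem_cat cs ?orbT.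
Qed.

Lemma blockE d h (k : int -> nat) K : {homo h : u v / (u <= v)%N >-> u <= v} ->
  (forall x, exists v, x <= h v) ->
  exists2 v, (K <= v)%N & forall i,
    block d h v i = if (radz i < K)%N then d (k i) else 0.
Proof.
move=> hmon hy.
pose s1 := mkseq (fun j => k (Posz j)) K; pose s2 := mkseq (fun j => k (Negz j)) K.
have [v0 v0h] := hy (\sum_(c <- s1 ++ s2) `|d c| `^ p).
(* A code above [v0] passes the size test in [block]. *)
have [|r rv] := @pickle_unbounded _ (fun r : nat => (s1, s2, r)) (maxn K v0).
  by move=> r s [].
exists (pickle (s1, s2, r)) => [|i]; first exact: leq_trans (leq_maxl _ _) rv.
rewrite /block pickleK/= (le_trans v0h)//; last first.
  by apply: hmon; apply: leq_trans (leq_maxr _ _) rv.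
have nthE f j : nth 0 (map d (mkseq f K)) j = if (j < K)%N then d (f j) else 0.
  case: ltnP => jK; last by rewrite nth_default// size_map size_mkseq.
  by rewrite (nth_map 0%N) ?size_mkseq// nth_mkseq.
by case: i => j; rewrite nthE.
Qed.

Lemma summable_hypercyclic (d : nat -> V) (S : R) :
  (forall (u : V) (e : R), 0 < e -> exists c, `|u - d c| < e) ->
  (forall K, wsum (fun i => a i `^ p) K <= S) -> frequently_hypercyclic B.
Proof.
move=> d_dense aS.
have a_gt0 i : 0 < a i by exact: scale_gt0.
have a_ge0 i : 0 <= a i by exact: ltW.
have ap_ge0 i : 0 <= a i `^ p by exact: powR_ge0.
have p0 : `|0 : V| `^ p = 0 by rewrite normr0 powR0 ?gt_eqF.
have [h [h0 hmon hy [S' haS]]] := slow_weight (fun i => powR_gt0 p (a_gt0 i)) aS.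
have [y yP] := @sparse_blocks R V (fun u => `|u| `^ p) h (block d h) p0 h0 hmon
  (fun v i => block_le d i (h0 v)).
(* Block 0 is centred at 0 and [logn 2 0] = 0, so [yP 0] controls every coordinate of [y]. *)
have y_le i : `|y i| `^ p <= h (radz i).
  have [] := yP 0%N i; rewrite /centre big_ord0 add0r logn0 => y0 y1.
  have [i0|] := leqP `|i|%N 0; last exact: y1.
  by rewrite y0//; move: i0; rewrite leqn0 absz_eq0 => /eqP->; exact: block_le.
pose z (i : int) := a i *: y i.
have normz (r : R) (u : V) : 0 <= r -> `|r *: u| `^ p = r `^ p * `|u| `^ p.
  by move=> r0; rewrite normrZ powRM// ger0_norm.
have z_lp : z \in lp_pred p1 V.
  apply: (@lp_of_wsum _ _ _ _ _ S') => K; apply: le_trans (haS K).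
  by apply: le_wsum => i _; rewrite normz// mulrC ler_wpM2r.
exists (Lp z_lp) => U openU [x Ux].
have /nbhs_ballP[e /= e0 xeU] : nbhs x U by exact: open_nbhs_nbhs.
have iterz n i : iter n B (Lp z_lp) i = a i *: y (i + n%:Z).
  rewrite (iter_wshiftE w_gt0) -[lp_val _ _]/(a (i + n%:Z) *: y (i + n%:Z)).
  by rewrite scalerA divfK ?gt_eqF.
pose e1 := (e / 2) `^ p.
have e1_gt0 : 0 < e1 by rewrite powR_gt0 ?divr_gt0.
(* [F] has bounded sums and dominates the p-th power of the error wherever that of the entry of [y]
   is at most [h]. *)
pose F i := 2 `^ p * (h (radz i) * a i `^ p + `|x i| `^ p).
have FS K : wsum F K <= 2 `^ p * (S' + `|x| `^ p).
  rewrite wsumM ler_wpM2l ?powR_ge0// wsumD lerD//.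
  exact: (lp_norm_le_wsum x (normr_ge0 _)).1.
have e12_gt0 : 0 < e1 / 2 by rewrite divr_gt0.
have [K tail] := wsum_tail FS e12_gt0.
have S_ge0 : 0 <= S by apply: le_trans (aS 0%N); rewrite /wsum big_ord0.
(* Coordinates in the window will have errors with p-th power at most e2 a_i^p, in total at most e2
   S <= e1 / 2; S + 1 avoids a division by 0. *)
pose e2 := e1 / 2 / (S + 1).
have e2_gt0 : 0 < e2 by rewrite !divr_gt0// ltr_wpDl.
pose e3 := e2 `^ p^-1.
have e3p : e3 `^ p = e2 by rewrite /e3 -powRrM mulVf ?gt_eqF// powRr1// ltW.
have /choice[k kP] : forall i, exists c, `|(a i)^-1 *: x i - d c| < e3.
  by move=> i; apply: d_dense; exact: powR_gt0.
have [v Kv blockE'] := @blockE d h k K hmon hy.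
have close m : logn 2 m = v -> U (iter (centre m) B (Lp z_lp)).
  move=> mv; apply: xeU; rewrite lp_ballE.
  apply: (@le_lt_trans _ _ (e / 2)); last by rewrite ltr_pdivrMr// ltr_pMr// ltr1n.
  apply/lp_norm_le_wsum; first by rewrite divr_ge0 ?ltW.
  move=> K'; apply: (@le_trans _ _ (wsum (fun i => e2 * a i `^ p +
    (K <= radz i)%N%:R * F i) K')).
    apply: le_wsum => i _.
    rewrite -[_ i]/(x i - iter (centre m) B (Lp z_lp) i) iterz [i + _]addrC.
    have [iK|Ki] := ltnP (radz i) K.
      rewrite mul0r addr0 (yP m i).1; last first.
        by rewrite mv (leq_trans _ Kv)//; case: i iK => j /=; lia.
      rewrite mv blockE' iK.
      have -> : x i - a i *: d (k i) = a i *: ((a i)^-1 *: x i - d (k i)).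
        by rewrite scalerBr scalerA mulfV ?scale1r// gt_eqF.
      rewrite normz// mulrC ler_wpM2r// -e3p ge0_ler_powR// ?nnegrE ?powR_ge0//.
      by rewrite ltW.
    (* Beyond the window, the entry is 0 inside the central block and bounded by [yP] outside of
       it. *)
    have yh : `|y ((centre m)%:Z + i)| `^ p <= h (radz i).
      have [iv|] := leqP `|i|%N (logn 2 m); last exact: (yP m i).2.
      by rewrite (yP m i).1// mv blockE' ltnNge Ki/= p0.
    rewrite mul1r; apply: ler_wpDl; first by rewrite mulr_ge0// ltW.
    apply: (@le_trans _ _ ((`|x i| + `|a i *: y ((centre m)%:Z + i)|) `^ p)).
      by rewrite ge0_ler_powR// ?nnegrE ?addr_ge0// ler_normB.
    have := powRD_le p1 ltr01 ltr01 (normr_ge0 (x i))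
      (normr_ge0 (a i *: y ((centre m)%:Z + i))).
    move=> /le_trans; apply; rewrite -mulrDr powR1 divr1 -[1 + 1]/(2 : R) normz//.
    rewrite -mulrA ler_wpM2l ?powR_ge0//.
    apply: (@le_trans _ _ (`|x i| `^ p + a i `^ p * `|y ((centre m)%:Z + i)| `^ p)).
      rewrite ler_piMl//; first by rewrite addr_ge0 ?mulr_ge0 ?powR_ge0.
      by lra.
    by rewrite addrC lerD2r mulrC ler_wpM2r.
  rewrite wsumD wsumM -/e1 (splitr e1) lerD//.
  apply: (@le_trans _ _ (e2 * S)); first by rewrite ler_wpM2l// ltW.
  by rewrite /e2 mulrAC ler_pdivrMr ?ltr_wpDl// ler_wpM2l ?divr_ge0 ?ltW// ltrDl.
(* The m with v_2(m) = v are the 2^v (2t + 1), and [centre_le] bounds their centres by 6 (2t + 1)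
   2^v <= 12 (t + 1) 2^v. *)
apply: (@lower_density_gt0 _ _ (fun t => centre (2 ^ v * t.*2.+1)) (12 * 2 ^ v)).
- move=> s t /eqP; apply: contraTeq => st; rewrite neq_ltn.
  move: st; rewrite neq_ltn => /orP[st|st]; apply/orP; [left|right];
    by apply: centre_lt; rewrite ltn_pmul2l ?expn_gt0// ltnS ltn_double.
- move=> t; apply/andP; split.
    by apply: leq_ltn_trans (leq0n (centre 0)) (centre_lt _);
      rewrite muln_gt0 expn_gt0.
  by apply: leq_trans (centre_le _) _; lia.
- move=> t; apply: close; rewrite lognM ?expn_gt0// pfactorK// logn_coprime ?addn0//.
  by rewrite coprime2n /= odd_double.
Qed.

End shift_dynamics.

(** * Real and complex scalars *)

Lemma recurrent_iff_hypercyclic (R : realType) (p : R) (p1 : 1 <= p)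
    (V : normedModType R) (e : V) (d : nat -> V) (w : int -> R)
    (w_bnd : bounded_fun w) :
  `|e| = 1 -> (forall (u : V) (r : R), 0 < r -> exists c, `|u - d c| < r) ->
  (forall k, 0 < w k) ->
  frequently_recurrent (wshift p1 V w_bnd) <->
  frequently_hypercyclic (wshift p1 V w_bnd).
Proof.
move=> e1 d_dense w_gt0; split; last exact: hypercyclic_recurrent.
by move=> /(recurrent_summable w_gt0 e1)[S]; exact: summable_hypercyclic d_dense.
Qed.

Lemma rat_approx (R : realType) (x r : R) : 0 < r ->
  exists q : rat, `|x - ratr q| < r.
Proof.
move=> r0; have /rat_in_itvoo[q] : x - r < x + r by lra.
by rewrite in_itv/= => xq; exists q; rewrite ltr_distlC.
Qed.

Definition rat_enum (R : realType) (c : nat) : R :=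
  ratr (odflt 0 (unpickle c)).

Definition rat2_enum (R : realType) (c : nat) : Rcomplex R :=
  let q := odflt (0, 0) (unpickle c) in (ratr q.1 +i* ratr q.2)%C.

Lemma rat_enum_dense (R : realType) (u : R^o) (r : R) : 0 < r ->
  exists c, `|u - rat_enum R c| < r.
Proof.
move=> /(rat_approx u)[q uq]; exists (pickle q).
by rewrite /rat_enum pickleK.
Qed.

Lemma Rcomplex_normE (R : realType) (z : Rcomplex R) :
  `|z| = Num.sqrt (complex.Re z ^+ 2 + complex.Im z ^+ 2).
Proof. by case: z. Qed.

Lemma rat2_enum_dense (R : realType) (u : Rcomplex R) (r : R) : 0 < r ->
  exists c, `|u - rat2_enum R c| < r.
Proof.
case: u => x y r0; have r20 : 0 < r / 2 by rewrite divr_gt0.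
have [q1 xq] := rat_approx x r20; have [q2 yq] := rat_approx y r20.
exists (pickle (q1, q2)); rewrite /rat2_enum pickleK/= Rcomplex_normE/=.
rewrite -(ger0_norm (ltW r0)) -sqrtr_sqr ltr_sqrt ?exprn_gt0//.
rewrite -(real_normK (num_real (x - _))) -(real_normK (num_real (y - _))).
have := normr_ge0 (x - ratr q1); have := normr_ge0 (y - ratr q2).
move: (`|_|) (`|_|) xq yq => s t; nra.
Qed.

Theorem proposition2p7 (R : realType) (p : R) (p1 : 1 <= p) (w : int -> R)
    (w_gt0 : forall k, 0 < w k) (w_bnd : bounded_fun w) :
  (frequently_recurrent (wshift p1 R^o w_bnd) <->
   frequently_hypercyclic (wshift p1 R^o w_bnd)) /\
  (frequently_recurrent (wshift p1 (Rcomplex R) w_bnd) <->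
   frequently_hypercyclic (wshift p1 (Rcomplex R) w_bnd)).
Proof.
split.
  apply: (@recurrent_iff_hypercyclic R p p1 R^o 1 (@rat_enum R)) => //.
    exact: normr1.
  exact: rat_enum_dense.
apply: (@recurrent_iff_hypercyclic R p p1 (Rcomplex R) 1 (@rat2_enum R)) => //.
  by rewrite Rcomplex_normE/= expr1n expr0n addr0 sqrtr1.
exact: rat2_enum_dense.
Qed.
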